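(* Let $\mathbb{I}=[t_-,t_+]$ be a compact interval, let $A\in C(\mathbb{I},L(\mathbb{R}^n))$ and let the solution operator $\Phi$ associated with $\dot x=A(t)x$ be attractive on $\mathbb{I}$. Then $$r(A)=-\overline{\lambda}(\mathbb{R}^n,\Phi).$$
   Context: Let $t_-<t_+$, $n\ge1$, and let $|\cdot|$ be a norm on $\mathbb{R}^n$ that is continuously differentiable on $\mathbb{R}^n\setminus\{0\}$, with unit sphere $\mathcal{S}$ and induced operator norm $\|\cdot\|$ on the space $L(\mathbb{R}^n)$ of linear operators. For $B\in C(\mathbb{I},L(\mathbb{R}^n))$, $\|B\|_\infty=\sup_{t\in\mathbb{I}}\|B(t)\|$. For $A\in C(\mathbb{I},L(\mathbb{R}^n))$ the solution operator $\Phi(t,s)$, $t,s\in\mathbb{I}$, is the evolution (transition) operator of $\dot x=A(t)x$. Its upper growth rate is $$\overline{\lambda}(\mathbb{R}^n,\Phi)=\sup\Big\{\frac{\ln|\Phi(t,t_-)x|-\ln|\Phi(s,t_-)x|}{t-s}: x\in\mathcal{S},\ t,s\in\mathbb{I},\ t\neq s\Big\}=\max\Big\{\frac{(|\Phi(\cdot,t_-)x|)'(t)}{|\Phi(t,t_-)x|}:t\in\mathbb{I},\ x\in\mathcal{S}\Big\}.$$ $\Phi$ (or $A$) is called attractive (attracting) on $\mathbb{I}$ if $\overline{\lambda}(\mathbb{R}^n,\Phi)<0$. If $A$ generates an attracting solution operator, its stability radius is $$r(A)=\inf\{\|B\|_\infty: B\in C(\mathbb{I},L(\mathbb{R}^n)),\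 A+B\text{ is not attracting on }\mathbb{I}\}.$$ *)

(* Defs.v *)
From HB Require Import structures.
From mathcomp Require Import all_boot all_order all_algebra.
From mathcomp Require Import all_classical all_reals all_analysis.

Set Implicit Arguments.
Unset Strict Implicit.
Unset Printing Implicit Defensive.

Import Order.TTheory GRing.Theory Num.Theory.
Import numFieldNormedType.Exports.
Local Open Scope classical_set_scope.
Local Open Scope ring_scope.

(* R^n is 'cV[R]_n and L(R^n) is 'M[R]_n acting by x |-> M *m x.  The library
   norm on these types is the max norm; here it only supplies the topology. The
   norm of the theory is an arbitrary function nu satisfying is_norm. *)

Record is_norm (R : realType) (n : nat) (nu : 'cV[R]_n -> R) : Prop := IsNorm {
  is_norm_triangle : forall x y, nu (x + y) <= nu x + nu y;
  is_norm_homog : forall (c : R) x, nu (c *: x) = `|c| * nu x;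
  is_norm_definite : forall x, nu x = 0 -> x = 0
}.

Definition gradient (R : realType) (n : nat) (f : 'cV[R]_n -> R)
    (x : 'cV[R]_n) : 'rV[R]_n :=
  \row_(j < n) ('d f x : 'cV[R]_n -> R) (delta_mx j 0).

Definition C1_off_zero (R : realType) (n : nat) (f : 'cV[R]_n -> R) : Prop :=
  forall x : 'cV[R]_n, x != 0 ->
    differentiable f x /\ {for x, continuous (gradient f)}.

Definition unit_sphere (R : realType) (n : nat) (nu : 'cV[R]_n -> R) :
    set 'cV[R]_n :=
  [set x | nu x = 1].

(* Suprema and infima are taken in \bar R: the real-valued sup and inf return
   the junk value 0 on sets that are unbounded or empty. *)

Definition op_norm (R : realType) (n : nat) (nu : 'cV[R]_n -> R)
    (M : 'M[R]_n) : \bar R :=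
  ereal_sup [set (nu (M *m x))%:E | x in unit_sphere nu].

Definition sup_norm (R : realType) (n : nat) (nu : 'cV[R]_n -> R)
    (tm tp : R) (B : R -> 'M[R]_n) : \bar R :=
  ereal_sup [set op_norm nu (B t) | t in `[tm, tp]].

(* Derivative along D: one-sided at the endpoints when D is an interval. *)
Definition is_derive_within (R : realType) (V : normedModType R) (D : set R)
    (f : R -> V) (t : R) (l : V) : Prop :=
  (s - t)^-1 *: (f s - f t) @[s --> within D t^'] --> l.

(* Only the values of A and Phi with time arguments in [tm, tp] matter. *)
Definition solution_operator (R : realType) (n : nat) (tm tp : R)
    (A : R -> 'M[R]_n) (Phi : R -> R -> 'M[R]_n) : Prop :=
  forall s, s \in `[tm, tp] ->
    Phi s s = 1%:M /\
    forall t, t \in `[tm, tp] ->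
      is_derive_within `[tm, tp] (fun u => Phi u s) t (A t *m Phi t s).

Definition upper_growth_rate (R : realType) (n : nat) (nu : 'cV[R]_n -> R)
    (tm tp : R) (Phi : R -> R -> 'M[R]_n) : \bar R :=
  ereal_sup [set q | exists x t s,
    [/\ unit_sphere nu x, t \in `[tm, tp], s \in `[tm, tp], t != s &
        q = ((ln (nu (Phi t tm *m x)) - ln (nu (Phi s tm *m x)))
             / (t - s))%:E]].

Definition attractive (R : realType) (n : nat) (nu : 'cV[R]_n -> R)
    (tm tp : R) (Phi : R -> R -> 'M[R]_n) : Prop :=
  (upper_growth_rate nu tm tp Phi < 0)%E.

(* A continuous A has a solution operator, unique on [tm, tp]^2, so asking for
   some solution operator is the same as speaking about the one generated by A. *)
Definition attracting (R : realType) (n : nat) (nu : 'cV[R]_n -> R)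
    (tm tp : R) (A : R -> 'M[R]_n) : Prop :=
  exists2 Phi, solution_operator tm tp A Phi & attractive nu tm tp Phi.

Definition stability_radius (R : realType) (n : nat) (nu : 'cV[R]_n -> R)
    (tm tp : R) (A : R -> 'M[R]_n) : \bar R :=
  ereal_inf [set sup_norm nu tm tp B | B in
    [set B : R -> 'M[R]_n | {within `[tm, tp], continuous B} /\
                            ~ attracting nu tm tp (fun t => A t + B t)]].

(* Main.v *)
Require Import Defs.
From HB Require Import structures.
From mathcomp Require Import all_boot all_order all_algebra.
From mathcomp Require Import all_classical all_reals all_analysis.
From mathcomp Require Import ring lra.

Set Implicit Arguments.
Unset Strict Implicit.
Unset Printing Implicit Defensive.

Import Order.TTheory GRing.Theory Num.Theory.
Import numFieldNormedType.Exports.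
Local Open Scope classical_set_scope.
Local Open Scope ring_scope.

(** By the chain rule, along a nonzero solution x of x' = A(t) x,
      (ln (nu x))' = 'd nu x (A x) / nu x,
    a quantity depending only on the time t and the current point x(t).  The
    mean value theorem bounds every difference quotient of ln (nu x) by values
    of this quantity; conversely each of its values is a limit of such quotients,
    because Phi t tm is invertible and a solution therefore passes through any
    given nonzero point at any given time.  Hence the upper growth rate is the
    supremum of 'd nu v (A t v) / nu v over t in ]tm, tp[ and v != 0
    ([upper_growth_rateE]), and this supremum reacts to a perturbation of A in a
    simple way:
    - Euler's identity 'd nu v v = nu v shows that adding c to A adds c to it,
      so the constant perturbation by minus the growth rate, whose norm is minus
      the growth rate, brings it to 0 and destroys attraction;
    - 'd nu v w <= nu w, a form of the triangle inequality, shows that adding B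
      raises it by at most the sup norm of B, so that no smaller perturbation
      can bring it up to 0.

    Being attracting includes having a solution operator, so the second point
    needs the existence of one for A + B.  The fundamental matrix is obtained by
    Picard iteration, which is a contraction with factor 1/2 for the norm with
    weight exp(-2D(t - a)) when D bounds n times the entries of A
    ([linear_ode_exists]).  Its invertibility, as well as that of any given
    solution operator, comes from the adjoint equation Y' = - Y A, since the
    product of a solution of the adjoint equation and one of the original
    equation is constant ([fundamental_matrix_unit]). *)

(** * Real functions on a segment *)

Definition clamp (R : realType) (a b t : R) : R := Num.max a (Num.min b t).

Lemma clamp_id (R : realType) (a b t : R) : t \in `[a, b] -> clamp a b t = t.
Proof.
rewrite in_itv /clamp /= => /andP[a_le_t t_le_b].
by rewrite (min_idPr t_le_b) (max_idPr a_le_t).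
Qed.

Lemma clamp_itv (R : realType) (a b t : R) : a <= b -> clamp a b t \in `[a, b].
Proof. by move=> ab; rewrite in_itv /clamp /= le_max lexx ge_max ab ge_min lexx. Qed.

Lemma continuous_clamp (R : realType) (a b : R) : continuous (clamp a b).
Proof.
move=> t; apply: continuous_max; first exact: cvg_cst.
by apply: continuous_min; [exact: cvg_cst|exact: cvg_id].
Qed.

(** A function that is continuous only along [a, b] is thereby replaced by one
    that is continuous on the whole line and agrees with it on [a, b]. *)
Lemma continuous_comp_clamp (R : realType) (T : topologicalType) (a b : R)
    (f : R -> T) : a <= b ->
  {within `[a, b], continuous f} -> continuous (f \o clamp a b).
Proof.
move=> ab /subspace_continuousP f_cont t.
have ct := clamp_itv t ab.
apply: (@cvg_comp _ _ _ _ _ _ (within `[a, b] (nbhs (clamp a b t)))).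
  move=> P; rewrite /within /= => nearP.
  have : \forall s \near t, `[a, b]%classic (clamp a b s) -> P (clamp a b s).
    exact: (@continuous_clamp R a b t _ nearP).
  apply: filterS => s; apply; exact: clamp_itv.
exact: f_cont.
Qed.

(** Integrating the clamped function from [a - 1] makes every point of [a, b],
    including [a] and [b], interior to the domain of integration, so that the
    derivative at the two endpoints is two-sided. *)
Definition primitive (R : realType) (a b : R) (f : R -> R) (t : R) : R :=
  let F s := \int[lebesgue_measure]_(u in `[a - 1, s]) f (clamp a b u) in
  F t - F a.

Lemma primitive_left (R : realType) (a b : R) (f : R -> R) :
  primitive a b f a = 0.
Proof. exact: subrr. Qed.

Lemma is_derive_primitive (R : realType) (a b : R) (f : R -> R) (t : R) :
  {within `[a, b], continuous f} -> t \in `[a, b] ->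
  is_derive t 1 (primitive a b f) (f t).
Proof.
move=> f_cont t_ab; have ab : a <= b.
  by move: t_ab; rewrite in_itv /= => /andP[/le_trans]; apply.
have g_cont := continuous_comp_clamp ab f_cont.
have g_int : lebesgue_measure.-integrable `[a - 1, t + 1]
    (EFin \o (f \o clamp a b)).
  apply: continuous_compact_integrable; first exact: segment_compact.
  exact: continuous_subspaceT.
have a1t : a - 1 < t by move: t_ab; rewrite in_itv /=; lra.
have t1 : t < t + 1 by rewrite ltrDl.
have [F_der] := continuous_FTC1_closed t1 g_int a1t (g_cont t).
rewrite /= clamp_id // => F_eq.
have F_is : is_derive t 1 (fun s => \int[lebesgue_measure]_(u in `[a - 1, s])
    (f \o clamp a b) u) (f t).
  by rewrite -F_eq derive1E; exact: derivableP.
have := is_deriveB F_is (is_derive_cst (\int[lebesgue_measure]_(u in `[a - 1, a])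
    (f \o clamp a b) u) t 1).
by rewrite subr0.
Qed.

(** Both G + F and G - F are nondecreasing. *)
Lemma mean_value_inequality (R : realType) (a b : R) (F G f g : R -> R) :
  (forall t, t \in `[a, b] -> is_derive t 1 F (f t)) ->
  (forall t, t \in `[a, b] -> is_derive t 1 G (g t)) ->
  (forall t, t \in `[a, b] -> `|f t| <= g t) ->
  forall t, t \in `[a, b] -> `|F t - F a| <= G t - G a.
Proof.
move=> dF dG fg t t_ab.
have ab : a <= b by move: t_ab; rewrite in_itv /= => /andP[/le_trans]; apply.
have a_ab : a \in `[a, b] by rewrite in_itv /= lexx.
have at_ : a <= t by move: t_ab; rewrite in_itv /= => /andP[].
have oc s : s \in `]a, b[ -> s \in `[a, b] by exact: subset_itv_oo_cc.
have mono (H h : R -> R) :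
    (forall s, s \in `[a, b] -> is_derive s 1 H (h s)) ->
    (forall s, s \in `[a, b] -> 0 <= h s) -> H a <= H t.
  move=> dH h_ge0; apply: (@ger0_derive1_le_cc _ H a b) => //.
  - by move=> s /oc s_ab; have [] := dH s s_ab.
  - move=> s /oc s_ab; rewrite derive1E.
    by have [_ ->] := dH s s_ab; exact: h_ge0.
  - apply: derivable_within_continuous => s s_ab.
    by have [] := dH s s_ab.
rewrite ler_norml; apply/andP; split.
- have := mono (G + F) (fun s => g s + f s).
  have -> : (G + F) a = G a + F a by [].
  have -> : (G + F) t = G t + F t by [].
  move=> /(_ _ _)/wrap[s /[dup] /dF dFs /dG dGs|s s_ab|]; last by lra.
    exact: is_deriveD.
  by have := fg s s_ab; rewrite ler_norml; lra.
- have := mono (G - F) (fun s => g s - f s).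
  have -> : (G - F) a = G a - F a by [].
  have -> : (G - F) t = G t - F t by [].
  move=> /(_ _ _)/wrap[s /[dup] /dF dFs /dG dGs|s s_ab|]; last by lra.
    exact: is_deriveB.
  by have := fg s s_ab; rewrite ler_norml; lra.
Qed.

Lemma constant_of_derive0 (R : realType) (a b : R) (F : R -> R) :
  (forall t, t \in `]a, b[ -> is_derive t 1 F 0) ->
  {within `[a, b], continuous F} ->
  forall t, t \in `[a, b] -> F t = F a.
Proof.
move=> dF F_cont t; rewrite in_itv /= => /andP[a_le_t t_le_b].
have [| |c _] := @MVT_segment R F (fun=> 0) a t a_le_t.
- move=> s; rewrite in_itv /= => /andP[as_ st]; apply: dF.
  by rewrite in_itv /= as_ (lt_le_trans st).
- by apply: continuous_subspaceW F_cont; apply: subset_itvl; rewrite bnd_simp.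
by rewrite mul0r => /subr0_eq.
Qed.

(** The explicit rate is what lets a sequence of functions inherit uniform
    convergence from a uniform bound K. *)
Lemma geometric_increments_cvg (R : realType) (u : nat -> R) (K : R) :
  (forall k, `|u k.+1 - u k| <= K / 2 ^+ k) ->
  exists l, forall k, `|u k - l| <= 2 * K / 2 ^+ k.
Proof.
move=> u_inc.
have K_ge0 : 0 <= K.
  by have := u_inc 0; rewrite expr0 divr1; exact: le_trans.
(* The tail from k on is dominated by the geometric tail, which telescopes. *)
have tail k m : `|u k - u (k + m)%N| <= 2 * K / 2 ^+ k.
  suff : `|u k - u (k + m)%N| <= 2 * K / 2 ^+ k - 2 * K / 2 ^+ (k + m).
    move=> /le_trans; apply; rewrite gerBl divr_ge0 ?mulr_ge0 ?exprn_ge0 //.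
  elim: m => [|m IH]; first by rewrite addn0 !subrr normr0.
  rewrite addnS; have := u_inc (k + m)%N.
  have -> : K / 2 ^+ (k + m) = 2 * K / 2 ^+ (k + m) - 2 * K / 2 ^+ (k + m).+1.
    by rewrite exprS; field; rewrite expf_neq0.
  rewrite distrC => H.
  have := ler_normD (u k - u (k + m)%N) (u (k + m)%N - u (k + m).+1).
  by rewrite subrKA; lra.
have small : (2 * K / 2 ^+ k) @[k --> \oo] --> 0.
  have := @cvg_geometric R (2 * K) (2^-1).
  rewrite ger0_norm ?invr_ge0 // invf_lt1 // ltr1n => /(_ isT).
  by apply: cvg_trans; apply: near_eq_cvg; near=> k; rewrite /= exprVn.
have u_cvg : cvgn u.
  apply/cauchy_cvgP/cauchy_exP => e e_gt0.
  have [N _ N_tail] := (cvgrPdist_lt _ _).1 small _ e_gt0.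
  exists (u N); exists N => // k N_le_k /=.
  have := N_tail N (leqnn N); rewrite /= sub0r normrN.
  have := tail N (k - N)%N; rewrite subnKC // -ball_normE /=.
  by have := ler_norm (2 * K / 2 ^+ N); lra.
exists (limn u) => k.
have u_shift : u (k + m)%N @[m --> \oo] --> limn u.
  have -> : (fun m => u (k + m)%N) = [sequence u (m + k)%N]_m.
    by apply/funext => m /=; rewrite addnC.
  by rewrite cvg_shiftn.
apply: (cvgr_to_le (cvg_norm (cvgB (cvg_cst (u k)) u_shift))).
by apply: nearW => m; exact: tail.
Unshelve. all: by end_near. Qed.

(** * Matrix-valued functions *)

Lemma uniform_approx_continuous (R : realType) (D : set R) (f : R -> R) :
  (forall e, 0 < e -> exists2 g : R -> R, {within D, continuous g} &
     forall t, D t -> `|g t - f t| <= e) ->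
  {within D, continuous f}.
Proof.
move=> approx; apply/subspace_continuousP => t Dt; apply/cvgrPdist_le => e e_gt0.
have e3_gt0 : 0 < e / 3 by rewrite divr_gt0.
have [g /subspace_continuousP g_cont gf] := approx _ e3_gt0.
have /cvgrPdist_le/(_ _ e3_gt0) near_g := g_cont t Dt.
near=> s.
have Ds : D s by near: s; exact: withinT.
have gs : `|g t - g s| <= e / 3 by near: s; exact: near_g.
have := gs; have := gf t Dt; have := gf s Ds.
rewrite /from_subspace !ler_norml; lra.
Unshelve. all: by end_near. Qed.

Lemma ler_entry_norm (R : realType) (m n : nat) (M : 'M[R]_(m, n)) i j :
  `|M i j| <= `|M|.
Proof.
rewrite [leRHS]/Num.Def.normr /= mx_normrE.
exact: (le_bigmax _ (fun p => `|M p.1 p.2|) (i, j)).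
Qed.

Lemma cvg_mx_entries (R : realType) (T : Type) (F : set_system T)
    (FF : Filter F) (m n : nat) (f : T -> 'M[R]_(m, n)) (M : 'M[R]_(m, n)) :
  (forall i j, f t i j @[t --> F] --> M i j) -> f @ F --> M.
Proof.
move=> fM; apply/cvgrPdist_le => e e_gt0; near=> t.
rewrite [leLHS]/Num.Def.normr /= mx_normrE (bigmax_le _ (ltW e_gt0)) //= => -[i j] _.
rewrite !mxE /=; move: i j; near: t.
apply: filter_forall => i; apply: filter_forall => j.
exact: (cvgrPdist_le _ _).1 (fM i j) e e_gt0.
Unshelve. all: by end_near. Qed.

Lemma within_continuous_mxP (R : realType) (D : set R) (m n : nat)
    (F : R -> 'M[R]_(m, n)) :
  {within D, continuous F} <->
  forall i j, {within D, continuous (fun t => F t i j)}.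
Proof.
split=> [/subspace_continuousP F_cont i j|F_cont].
  apply/subspace_continuousP => t Dt.
  apply: (@cvg_comp _ _ _ F (fun M : 'M[R]_(m, n) => M i j)); first exact: F_cont.
  exact: coord_continuous.
apply/subspace_continuousP => t Dt; apply: cvg_mx_entries => i j.
by have /subspace_continuousP := F_cont i j; apply.
Qed.

Lemma within_continuous_mulmx (R : realType) (D : set R) (m n p : nat)
    (F : R -> 'M[R]_(m, n)) (G : R -> 'M[R]_(n, p)) :
  {within D, continuous F} -> {within D, continuous G} ->
  {within D, continuous (fun t => F t *m G t)}.
Proof.
move=> /within_continuous_mxP F_cont /within_continuous_mxP G_cont.
apply/within_continuous_mxP => i j.
under eq_fun do rewrite mxE.
apply: continuous_big => [|k _ t]; first exact: add_continuous.
by apply: cvgM; [exact: F_cont|exact: G_cont].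
Qed.

Lemma is_derive_mxP (R : realType) (m n : nat) (F : R -> 'M[R]_(m, n)) (t : R)
    (L : 'M[R]_(m, n)) :
  is_derive t 1 F L <-> forall i j, is_derive t 1 (fun u => F u i j) (L i j).
Proof.
split=> [[F_der <-] i j|F_der].
  have Fij_der := (derivable_mxP F t 1).1 F_der i j.
  by rewrite derive_mx // mxE; exact: derivableP.
have F_d : derivable F t 1 by apply/derivable_mxP => i j; have [] := F_der i j.
apply: DeriveDef => //; rewrite derive_mx //; apply/matrixP => i j.
by rewrite mxE; have [] := F_der i j.
Qed.

Lemma is_derive_mulmx (R : realType) (m n p : nat) (F : R -> 'M[R]_(m, n))
    (G : R -> 'M[R]_(n, p)) (t : R) (F' : 'M[R]_(m, n)) (G' : 'M[R]_(n, p)) :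
  is_derive t 1 F F' -> is_derive t 1 G G' ->
  is_derive t 1 (fun u => F u *m G u) (F' *m G t + F t *m G').
Proof.
move=> /is_derive_mxP dF /is_derive_mxP dG; apply/is_derive_mxP => i j.
have -> : (fun u => (F u *m G u) i j)
    = \sum_k (fun u => F u i k) * (fun u => G u k j).
  by apply/funext => u; rewrite mxE fct_sumE.
rewrite !mxE -big_split /=; apply: is_derive_sum => k.
have := is_deriveM (dF i k) (dG k j).
by rewrite addrC ![_ *: _]mulrC [_ * F t i k]mulrC.
Qed.

(** * Existence for linear differential equations *)

Lemma within_continuous_bounded (R : realType) (m n : nat) (a b : R)
    (F : R -> 'M[R]_(m, n)) : a <= b -> {within `[a, b], continuous F} ->
  exists K, forall t, t \in `[a, b] -> `|F t| <= K.
Proof.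
move=> ab F_cont.
have nF_cont : {within `[a, b], continuous (fun t => `|F t|)}.
  by move=> t; apply: cvg_norm; exact: F_cont.
have [c _ F_le] := EVT_max ab nF_cont.
by exists `|F c|.
Qed.

(** The weight exp(2D(t - a)) grows at twice the rate D at which the equation can
    amplify an error, hence the gain of a factor 1/2 upon integration. *)
Lemma is_derive_weight (R : realType) (a D c t : R) : c != 0 ->
  is_derive t 1 (fun s => expR (2 * D * (s - a)) / (2 * c))
    (D * expR (2 * D * (t - a)) / c).
Proof.
move=> c_neq0; pose L (s : R) := 2 * D * (s - a).
have dL : is_derive t 1 L (2 * D).
  have := is_deriveZ (2 * D) (is_deriveB (is_derive_id t 1) (is_derive_cst a t 1)).
  by rewrite subr0 [_ *: _]mulr1.
have dE := is_derive1_comp (is_derive_expR (L t)) dL.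
have -> : (fun s => expR (2 * D * (s - a)) / (2 * c))
    = (2 * c)^-1 \*: (expR \o L).
  by apply/funext => s; rewrite /= [_ *: _]mulrC.
have -> : D * expR (2 * D * (t - a)) / c = (2 * c)^-1 *: (expR (L t) * (2 * D)).
  by rewrite /L /GRing.scale /=; field.
exact: is_deriveZ.
Qed.

Lemma ler_mulmx_entry (R : realType) (m n p : nat) (A : 'M[R]_(m, n))
    (B : 'M[R]_(n, p)) (K L : R) :
  0 <= K -> (forall i j, `|A i j| <= K) -> (forall i j, `|B i j| <= L) ->
  forall i j, `|(A *m B) i j| <= n%:R * K * L.
Proof.
move=> K_ge0 A_le B_le i j; rewrite mxE.
apply: (le_trans (ler_norm_sum _ _ _)).
have -> : n%:R * K * L = \sum_(k < n) K * L.
  by rewrite sumr_const card_ord -[RHS]mulr_natl mulrA.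
by apply: ler_sum => k _; rewrite normrM ler_pM.
Qed.

(** The integral operator X |-> 1 + int_a A X; its fixed points are the solutions
    of X' = A X with X a = 1. *)
Definition picard_step (R : realType) (n : nat) (a b : R) (A X : R -> 'M[R]_n)
    (t : R) : 'M[R]_n :=
  \matrix_(i, j) (1%:M i j + primitive a b (fun u => (A u *m X u) i j) t).

Lemma picard_step_left (R : realType) (n : nat) (a b : R) (A X : R -> 'M[R]_n) :
  picard_step a b A X a = 1%:M.
Proof. by apply/matrixP => i j; rewrite mxE primitive_left addr0. Qed.

Lemma is_derive_picard_step (R : realType) (n : nat) (a b : R)
    (A X : R -> 'M[R]_n) (t : R) :
  {within `[a, b], continuous A} -> {within `[a, b], continuous X} ->
  t \in `[a, b] -> is_derive t 1 (picard_step a b A X) (A t *m X t).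
Proof.
move=> A_cont X_cont t_ab; apply/is_derive_mxP => i j.
have AX_cont := within_continuous_mulmx A_cont X_cont.
have dAX := is_derive_primitive ((within_continuous_mxP _ _).1 AX_cont i j) t_ab.
have := is_deriveD (is_derive_cst ((1%:M : 'M[R]_n) i j) t 1) dAX.
rewrite add0r; set F := _ + _.
by have -> : F = fun u => picard_step a b A X u i j
  by apply/funext => u; rewrite mxE.
Qed.

Lemma continuous_picard_step (R : realType) (n : nat) (a b : R)
    (A X : R -> 'M[R]_n) :
  {within `[a, b], continuous A} -> {within `[a, b], continuous X} ->
  {within `[a, b], continuous (picard_step a b A X)}.
Proof.
move=> A_cont X_cont; apply: derivable_within_continuous => t t_ab.
by have [] := is_derive_picard_step A_cont X_cont t_ab.
Qed.

(** Contraction for the weighted norm: the derivative of the difference of the two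
    images is A (X - Y), which is at most D times the given bound, that is, the
    derivative of half of that bound. *)
Lemma picard_step_contraction (R : realType) (n : nat) (a b D c : R)
    (A X Y : R -> 'M[R]_n) :
  0 < c -> {within `[a, b], continuous A} ->
  {within `[a, b], continuous X} -> {within `[a, b], continuous Y} ->
  0 <= D -> (forall t, t \in `[a, b] -> n%:R * `|A t| <= D) ->
  (forall t, t \in `[a, b] -> forall i j,
     `|X t i j - Y t i j| <= expR (2 * D * (t - a)) / c) ->
  forall t, t \in `[a, b] -> forall i j,
    `|picard_step a b A X t i j - picard_step a b A Y t i j|
      <= expR (2 * D * (t - a)) / (2 * c).
Proof.
move=> c_gt0 A_cont X_cont Y_cont D_ge0 A_le XY t t_ab i j.
pose F s := picard_step a b A X s i j - picard_step a b A Y s i j.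
pose G s := expR (2 * D * (s - a)) / (2 * c).
have F_a : F a = 0 by rewrite /F !picard_step_left subrr.
suff : `|F t - F a| <= G t - G a.
  rewrite F_a subr0 => /le_trans; apply; rewrite gerBl.
  by rewrite divr_ge0 ?expR_ge0 // mulr_ge0 // ltW.
apply: (mean_value_inequality (f := fun s => (A s *m (X s - Y s)) i j)
  (g := fun s => D * expR (2 * D * (s - a)) / c) (b := b)) => // s s_ab.
- have /is_derive_mxP/(_ i j) dX := is_derive_picard_step A_cont X_cont s_ab.
  have /is_derive_mxP/(_ i j) dY := is_derive_picard_step A_cont Y_cont s_ab.
  by rewrite mulmxBr !mxE; have := is_deriveB dX dY; rewrite !mxE.
- by apply: is_derive_weight; rewrite gt_eqF.
- have := @ler_mulmx_entry _ _ _ _ (A s) (X s - Y s) `|A s|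
    (expR (2 * D * (s - a)) / c) (normr_ge0 _) (ler_entry_norm _).
  move=> /(_ _ i j)/le_trans; apply; first by move=> k l; rewrite !mxE; exact: XY.
  rewrite -[leRHS]mulrA ler_wpM2r ?A_le // divr_ge0 ?expR_ge0 //.
  exact: ltW.
Qed.

(** The iterates started at 0 have increments at most exp(2D(t - a)) / 2^k, so they
    converge uniformly on [a, b].  The limit X is continuous, hence so is A X, and
    one more Picard step turns X into a differentiable function; this function is
    X again because the step is a contraction. *)
Lemma linear_ode_exists (R : realType) (n : nat) (a b : R) (A : R -> 'M[R]_n) :
  a <= b -> {within `[a, b], continuous A} ->
  exists X : R -> 'M[R]_n, X a = 1%:M /\
    forall t, t \in `[a, b] -> is_derive t 1 X (A t *m X t).
Proof.
move=> ab A_cont.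
have [K A_le] := within_continuous_bounded ab A_cont.
have a_ab : a \in `[a, b] by rewrite in_itv /= lexx.
have K_ge0 : 0 <= K by apply: le_trans (A_le a a_ab); exact: normr_ge0.
pose D := n%:R * K; have D_ge0 : 0 <= D by rewrite mulr_ge0.
have A_le_D t : t \in `[a, b] -> n%:R * `|A t| <= D.
  by move=> t_ab; rewrite ler_wpM2l // A_le.
pose P k := iter k (picard_step a b A) (fun=> 0).
pose E t : R := expR (2 * D * (t - a)).
have P_cont k : {within `[a, b], continuous (P k)}.
  elim: k => [|k IH]; first by apply: continuous_subspaceT => t; exact: cvg_cst.
  exact: continuous_picard_step.
have E_ge1 t : t \in `[a, b] -> 1 <= E t.
  rewrite in_itv /= => /andP[at_ _].
  by rewrite -expR0 ler_expR !mulr_ge0 // subr_ge0.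
have P_inc k t : t \in `[a, b] -> forall i j,
    `|P k.+1 t i j - P k t i j| <= E t / 2 ^+ k.
  elim: k t => [|k IH] t t_ab i j.
    (* The first iterate is the identity, as the integrand A 0 vanishes. *)
    have -> : P 1%N t i j = 1%:M i j.
      rewrite /P /= mxE /primitive -[RHS]addr0; congr (_ + _).
      have F0 s : \int[lebesgue_measure]_(u in `[a - 1, s])
          (A (clamp a b u) *m (0 : 'M[R]_n)) i j = 0.
        under eq_Rintegral do rewrite mulmx0 mxE.
        by rewrite Rintegral_cst // mul0r.
      by rewrite !F0 subrr.
    rewrite /P /= !mxE subr0 expr0 divr1 normr_nat.
    by apply: le_trans (E_ge1 t t_ab); case: (i == j).
  rewrite exprS.
  exact: (@picard_step_contraction _ _ a b D (2 ^+ k) A (P k.+1) (P k)).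
have P_cvg (p : R * 'I_n * 'I_n) : exists l : R, p.1.1 \in `[a, b] ->
    forall k, `|P k p.1.1 p.1.2 p.2 - l| <= 2 * E p.1.1 / 2 ^+ k.
  case: p => -[t i] j /=.
  have [t_ab|] := boolP (t \in `[a, b]); last by exists 0.
  have [l Pl] := @geometric_increments_cvg R (fun k => P k t i j) (E t)
    (fun k => P_inc k t t_ab i j).
  by exists l.
(* The limit is chosen at all times and entries together; outside [a, b] its
   values are arbitrary. *)
have [l P_l] := choice P_cvg.
pose X t := \matrix_(i, j) l (t, i, j).
have P_X k t : t \in `[a, b] -> forall i j,
    `|P k t i j - X t i j| <= 2 * E t / 2 ^+ k.
  by move=> t_ab i j; rewrite mxE; exact: P_l (t, i, j) t_ab k.
have small (K' e : R) : 0 < e -> exists k, K' / 2 ^+ k <= e.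
  have := @cvg_geometric R K' (2^-1).
  rewrite ger0_norm ?invr_ge0 // invf_lt1 // ltr1n => /(_ isT) K'_to0 e_gt0.
  have [k _ k_small] := (cvgrPdist_le _ _).1 K'_to0 _ e_gt0.
  exists k; have := k_small k (leqnn k).
  by rewrite /= sub0r normrN exprVn; apply: le_trans; exact: ler_norm.
have E_le t : t \in `[a, b] -> E t <= E b.
  rewrite in_itv /= => /andP[_ tb].
  by rewrite ler_expR ler_wpM2l ?mulr_ge0 // lerD2r.
have X_cont : {within `[a, b], continuous X}.
  apply/within_continuous_mxP => i j.
  apply: uniform_approx_continuous => e e_gt0.
  have [k k_small] := small (2 * E b) e e_gt0.
  exists (fun t => P k t i j); first exact: (within_continuous_mxP _ _).1.
  move=> t t_ab; apply: le_trans (P_X k t t_ab i j) _; apply: le_trans k_small.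
  by rewrite ler_pM2r ?invr_gt0 ?exprn_gt0 // ler_wpM2l // E_le.
exists (picard_step a b A X); split; first exact: picard_step_left.
have X_fix t : t \in `[a, b] -> picard_step a b A X t = X t.
  move=> t_ab; apply/matrixP => i j; apply/eqP; rewrite -subr_eq0 -normr_le0.
  apply/ler_addgt0Pr => e e_gt0; rewrite add0r.
  have [k k_small] := small (2 * E b) e e_gt0.
  have step_small : `|P k.+1 t i j - picard_step a b A X t i j|
      <= E t / 2 ^+ k.
    (* The contraction lemma is used with c := 2 ^+ k / 2, for which E / c is the
       bound 2 E / 2^k on the distance from the k-th iterate to X. *)
    have -> : E t / 2 ^+ k = E t / (2 * (2 ^+ k / 2)).
      by congr (_ / _); field.
    have c_gt0 : 0 < 2 ^+ k / 2 :> R by rewrite divr_gt0 // exprn_gt0.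
    apply: (picard_step_contraction c_gt0 A_cont (P_cont k) X_cont D_ge0) => //.
    move=> s s_ab p q; apply: le_trans (P_X k s s_ab p q) _.
    by rewrite le_eqVlt; apply/orP; left; apply/eqP; rewrite /E; field.
  have := P_X k.+1 t t_ab i j.
  have -> : 2 * E t / 2 ^+ k.+1 = E t / 2 ^+ k by rewrite exprS; field.
  have : 2 * (E t / 2 ^+ k) <= e.
    apply: le_trans k_small; rewrite mulrA.
    by rewrite ler_pM2r ?invr_gt0 ?exprn_gt0 // ler_wpM2l // E_le.
  by move: step_small; rewrite !ler_norml; lra.
move=> t t_ab; rewrite X_fix //.
exact: is_derive_picard_step.
Qed.

(** * Solution operators *)

Lemma is_derive_to_within (R : realType) (V : normedModType R) (D : set R)
    (f : R -> V) (t : R) (l : V) :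
  is_derive t 1 f l -> is_derive_within D f t l.
Proof.
case=> f_der f_l; have : h^-1 *: (f (h *: 1 + t) - f t) @[h --> 0^'] --> l.
  by rewrite -f_l; exact: f_der.
move=> f_cvg.
have : (s - t)^-1 *: (f s - f t) @[s --> t^'] --> l.
  have -> : (fun s => (s - t)^-1 *: (f s - f t))
      = (fun h => h^-1 *: (f (h *: 1 + t) - f t)) \o (fun s => s - t).
    by apply/funext => s /=; rewrite [_ *: 1]mulr1 subrK.
  apply: (cvg_comp _ _ _ f_cvg) => P [e /= e_gt0 Pe]; exists e => //= s st s_neq.
  apply: Pe; rewrite /= ?subr_eq0 //.
  by move: st; rewrite /ball_ /= sub0r opprB.
by apply: cvg_trans; apply: cvg_app; exact: cvg_within.
Qed.

Lemma is_derive_of_within (R : realType) (V : normedModType R) (a b : R)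
    (f : R -> V) (t : R) (l : V) :
  t \in `]a, b[ -> is_derive_within `[a, b] f t l -> is_derive t 1 f l.
Proof.
move=> t_ab f_l.
have f_cvg : h^-1 *: (f (h *: 1 + t) - f t) @[h --> 0^'] --> l.
  have -> : (fun h => h^-1 *: (f (h *: 1 + t) - f t))
      = (fun s => (s - t)^-1 *: (f s - f t)) \o (fun h => h + t).
    by apply/funext => h /=; rewrite [_ *: 1]mulr1 addrK.
  apply: (cvg_comp (fun h : R => h + t) _ _ f_l) => P P_near.
  have ab_near : \forall s \near t, s \in `[a, b].
    near=> s; apply: subset_itv_oo_cc; near: s.
    exact: near_in_itvoo.
  have [e /= e_gt0 Pe] : \forall s \near t, s != t -> P s.
    near=> s => s_neq.
    have : s != t -> `[a, b]%classic s -> P s by near: s; exact: P_near.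
    by apply => //; near: s; exact: ab_near.
  exists e => //= h h_e h_neq; apply: Pe; last by rewrite -subr_eq0 addrK.
  by move: h_e; rewrite /ball_ /= sub0r opprD addrCA subrr addr0.
apply: DeriveDef; first by apply/cvg_ex; exists l.
exact: cvg_lim f_cvg.
Unshelve. all: by end_near. Qed.

Lemma continuous_of_within (R : realType) (V : normedModType R) (D : set R)
    (f f' : R -> V) :
  (forall t, D t -> is_derive_within D f t (f' t)) -> {within D, continuous f}.
Proof.
move=> f_der; apply/subspace_continuousP => t Dt.
have num_cvg : f s - f t @[s --> within D t^'] --> (0 : V).
  have t_cvg : s - t @[s --> within D t^'] --> (0 : R).
    rewrite -(subrr t); apply: cvgB; last exact: cvg_cst.
    move=> P tP; have : \forall s \near t, s != t -> D s -> P s.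
      by near=> s => _ _; near: s; exact: tP.
    exact.
  have num0 : (s - t) *: ((s - t)^-1 *: (f s - f t))
      @[s --> within D t^'] --> (0 : V).
    by rewrite -(scale0r (f' t)); exact: (cvgZ t_cvg (f_der t Dt)).
  apply: cvg_trans num0.
  apply: near_eq_cvg; near=> s.
  rewrite /= scalerA mulfV ?scale1r // subr_eq0; near: s.
  have : \forall s \near t, s != t -> D s -> s != t by near=> s.
  exact.
apply/cvgrPdist_lt => e e_gt0.
have near_t : \forall s \near within D t^', `|f s - f t| < e.
  by have /cvgrPdist_lt/(_ _ e_gt0) := num_cvg; apply: filterS => s; rewrite sub0r normrN.
have near_t' : \forall s \near t, s != t -> D s -> `|f s - f t| < e := near_t.
near=> s.
have [->|s_neq] := eqVneq s t; first by rewrite subrr normr0.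
rewrite distrC.
have : s != t -> D s -> `|f s - f t| < e.
  by near: s; apply: cvg_within; exact: near_t'.
apply => //; near: s; exact: withinT.
Unshelve. all: by end_near. Qed.

(** If Y solves the adjoint equation Y' = - Y A with Y a = 1, then Y X has
    derivative - Y A X + Y A X = 0, hence stays equal to 1, and X has the left
    inverse Y.  The adjoint equation is obtained by transposing the equation with
    coefficient - A^T. *)
Lemma fundamental_matrix_unit (R : realType) (n : nat) (a b : R)
    (A X : R -> 'M[R]_n) :
  {within `[a, b], continuous A} -> {within `[a, b], continuous X} ->
  X a = 1%:M ->
  (forall t, t \in `]a, b[ -> is_derive t 1 X (A t *m X t)) ->
  forall t, t \in `[a, b] -> X t \in unitmx.
Proof.
move=> A_cont X_cont X_a dX t t_ab.
have ab : a <= b by move: t_ab; rewrite in_itv /= => /andP[/le_trans]; apply.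
have N_cont : {within `[a, b], continuous (fun s => - (A s)^T)}.
  apply/within_continuous_mxP => i j.
  have -> : (fun s => (- (A s)^T) i j) = fun s => - A s j i.
    by apply/funext => s; rewrite !mxE.
  by move=> s; apply: cvgN; apply: (within_continuous_mxP _ _).1.
have [W [W_a dW]] := linear_ode_exists ab N_cont.
pose Y s := (W s)^T.
have dY s : s \in `[a, b] -> is_derive s 1 Y (- (Y s *m A s)).
  move=> /dW /is_derive_mxP dWs; apply/is_derive_mxP => i j.
  have -> : (fun u => Y u i j) = fun u => W u j i.
    by apply/funext => u; rewrite /Y mxE.
  have -> : - (Y s *m A s) = (- (A s)^T *m W s)^T.
    by rewrite trmx_mul linearN /= trmxK mulmxN.
  by rewrite mxE.
have Y_cont : {within `[a, b], continuous Y}.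
  by apply: derivable_within_continuous => s /dY[].
have dYX s i j : s \in `]a, b[ -> is_derive s 1 (fun s => (Y s *m X s) i j) 0.
  move=> s_ab.
  have := is_derive_mulmx (dY s (subset_itv_oo_cc s_ab)) (dX s s_ab).
  by rewrite mulNmx mulmxA addNr => /is_derive_mxP/(_ i j); rewrite mxE.
have YX_cont := within_continuous_mulmx Y_cont X_cont.
have YX_const i j : (Y t *m X t) i j = (Y a *m X a) i j.
  have YXij_cont := (within_continuous_mxP _ _).1 YX_cont i j.
  exact: (constant_of_derive0 (fun s => dYX s i j) YXij_cont t_ab).
have YX1 : Y t *m X t = 1%:M.
  by apply/matrixP => i j; rewrite YX_const X_a /Y W_a trmx1 mulmx1.
by have [] := mulmx1_unit YX1.
Qed.

Lemma solution_operator_continuous (R : realType) (n : nat) (a b s : R)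
    (A : R -> 'M[R]_n) (Phi : R -> R -> 'M[R]_n) :
  solution_operator a b A Phi -> s \in `[a, b] ->
  {within `[a, b], continuous (fun t => Phi t s)}.
Proof.
move=> Phi_sol /Phi_sol[_ dPhi].
by apply: (continuous_of_within (f' := fun t => A t *m Phi t s)) => t; exact: dPhi.
Qed.

Lemma solution_operator_is_derive (R : realType) (n : nat) (a b s t : R)
    (A : R -> 'M[R]_n) (Phi : R -> R -> 'M[R]_n) :
  solution_operator a b A Phi -> s \in `[a, b] -> t \in `]a, b[ ->
  is_derive t 1 (fun u => Phi u s) (A t *m Phi t s).
Proof.
move=> Phi_sol /Phi_sol[_ dPhi] t_ab.
apply: (is_derive_of_within t_ab); apply: dPhi; exact: subset_itv_oo_cc.
Qed.

Lemma solution_operator_unit (R : realType) (n : nat) (a b t : R)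
    (A : R -> 'M[R]_n) (Phi : R -> R -> 'M[R]_n) :
  {within `[a, b], continuous A} -> solution_operator a b A Phi ->
  t \in `[a, b] -> Phi t a \in unitmx.
Proof.
move=> A_cont Phi_sol t_ab.
have a_ab : a \in `[a, b].
  by move: t_ab; rewrite !in_itv /= lexx => /andP[/le_trans]; apply.
apply: (@fundamental_matrix_unit _ _ a b A (fun t => Phi t a)) => //.
- exact: solution_operator_continuous Phi_sol a_ab.
- by have [] := Phi_sol a a_ab.
- by move=> u u_ab; exact: solution_operator_is_derive Phi_sol a_ab u_ab.
Qed.

(** Phi(t, s) = X(t) X(s)^-1 for the fundamental matrix X normalized at a. *)
Lemma solution_operator_exists (R : realType) (n : nat) (a b : R)
    (A : R -> 'M[R]_n) : a <= b -> {within `[a, b], continuous A} ->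
  exists Phi, solution_operator a b A Phi.
Proof.
move=> ab A_cont; have [X [X_a dX]] := linear_ode_exists ab A_cont.
have X_cont : {within `[a, b], continuous X}.
  by apply: derivable_within_continuous => t /dX[].
have X_unit := fundamental_matrix_unit A_cont X_cont X_a
  (fun t t_ab => dX t (subset_itv_oo_cc t_ab)).
exists (fun t s => X t *m invmx (X s)) => s s_ab; split.
  exact: mulmxV (X_unit s s_ab).
move=> t t_ab; apply: is_derive_to_within.
have := is_derive_mulmx (dX t t_ab) (is_derive_cst (invmx (X s)) t 1).
by rewrite mulmx0 addr0 mulmxA.
Qed.

Lemma is_derive_comp_differentiable (R : realType) (V : normedModType R)
    (f : V -> R) (x : R -> V) (t : R) (x' : V) :
  is_derive t 1 x x' -> differentiable f (x t) ->
  is_derive t 1 (f \o x) (('d f (x t) : V -> R) x').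
Proof.
move=> [/derivable1_diffP x_diff <-] f_diff.
have fx_diff : differentiable (f \o x) t by exact: differentiable_comp.
apply: DeriveDef; first exact/derivable1_diffP.
by rewrite !deriveE // diff_comp.
Qed.

(** * Norms and their differentials *)

Lemma is_norm0 (R : realType) (n : nat) (nu : 'cV[R]_n -> R) :
  is_norm nu -> nu 0 = 0.
Proof.
by move=> nu_norm; rewrite -(scale0r (0 : 'cV_n)) is_norm_homog // normr0 mul0r.
Qed.

Lemma is_norm_ge0 (R : realType) (n : nat) (nu : 'cV[R]_n -> R) x :
  is_norm nu -> 0 <= nu x.
Proof.
move=> nu_norm; have := is_norm_triangle nu_norm x (-1 *: x).
rewrite is_norm_homog // normrN1 mul1r scaleN1r subrr is_norm0 //; lra.
Qed.

Lemma is_norm_gt0 (R : realType) (n : nat) (nu : 'cV[R]_n -> R) x :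
  is_norm nu -> x != 0 -> 0 < nu x.
Proof.
move=> nu_norm x_neq0; rewrite lt_neqAle is_norm_ge0 // andbT eq_sym.
by apply: contra_neq x_neq0; exact: is_norm_definite.
Qed.

Lemma normalize_unit_sphere (R : realType) (n : nat) (nu : 'cV[R]_n -> R) x :
  is_norm nu -> x != 0 -> unit_sphere nu ((nu x)^-1 *: x).
Proof.
move=> nu_norm x_neq0; have x_gt0 := is_norm_gt0 nu_norm x_neq0.
rewrite /unit_sphere /= is_norm_homog // ger0_norm ?mulVf ?gt_eqF //.
by rewrite invr_ge0 ltW.
Qed.

(** Every difference quotient of the norm in the direction w is at most nu w by the
    triangle inequality, whatever the sign of the increment. *)
Lemma diff_norm_le (R : realType) (n : nat) (nu : 'cV[R]_n -> R)
    (v w : 'cV[R]_n) :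
  is_norm nu -> differentiable nu v ->
  ('d nu v : 'cV[R]_n -> R) w <= nu w.
Proof.
move=> nu_norm nu_diff; rewrite -deriveE //.
have nu_cvg : cvg (h^-1 *: (nu (h *: w + v) - nu v) @[h --> 0^']).
  exact: diff_derivable.
apply: (cvgr_to_le nu_cvg); near=> h.
have h_neq0 : h != 0 by near: h; exact: nbhs_dnbhs_neq.
have [h_gt0|h_lt0|h0] := ltgtP 0 h; last by rewrite -h0 eqxx in h_neq0.
  rewrite [_ *: _]mulrC ler_pdivrMr // lerBlDr.
  apply: le_trans (is_norm_triangle nu_norm _ _) _.
  by rewrite is_norm_homog // gtr0_norm // mulrC.
rewrite [_ *: _]mulrC ler_ndivrMr //.
have := is_norm_triangle nu_norm (h *: w + v) (- h *: w).
rewrite is_norm_homog // normrN ltr0_norm //.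
rewrite scaleNr [h *: w + v]addrC addrK mulNr; lra.
Unshelve. all: by end_near. Qed.

(** Euler's identity for functions that are homogeneous of degree 1: along the ray
    of v the norm is affine, with slope nu v. *)
Lemma diff_norm_self (R : realType) (n : nat) (nu : 'cV[R]_n -> R)
    (v : 'cV[R]_n) :
  is_norm nu -> differentiable nu v ->
  ('d nu v : 'cV[R]_n -> R) v = nu v.
Proof.
move=> nu_norm nu_diff; rewrite -deriveE //; apply: cvg_lim => //.
suff quot : \forall h \near (0 : R)^', nu v = h^-1 *: (nu (h *: v + v) - nu v).
  by apply: cvg_trans (near_eq_cvg quot) _; exact: cvg_cst.
near=> h.
have h_neq0 : h != 0 by near: h; exact: nbhs_dnbhs_neq.
have h_gtN1 : `|h| < 1 by near: h; exact: dnbhs0_lt.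
have -> : h *: v + v = (h + 1) *: v by rewrite scalerDl scale1r.
rewrite is_norm_homog // ger0_norm; last first.
  by move: h_gtN1; rewrite ltr_norml; lra.
by rewrite /GRing.scale /=; field.
Unshelve. all: by end_near. Qed.

(** * The growth rate as a supremum of instantaneous rates *)

(** The logarithmic derivative of the norm along the solution that is at v at time
    t.  Times in the open interval suffice: they are the ones that the mean value
    theorem provides, and the derivatives there are two-sided. *)
Definition infinitesimal_growth (R : realType) (n : nat) (nu : 'cV[R]_n -> R)
    (a b : R) (A : R -> 'M[R]_n) : \bar R :=
  ereal_sup [set q | exists t v, [/\ t \in `]a, b[, v != 0 &
    q = (('d nu v : 'cV[R]_n -> R) (A t *m v) / nu v)%:E]].

Lemma is_derive_ln_norm (R : realType) (n : nat) (nu : 'cV[R]_n -> R)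
    (x : R -> 'cV[R]_n) (t : R) (x' : 'cV[R]_n) :
  is_norm nu -> C1_off_zero nu -> x t != 0 -> is_derive t 1 x x' ->
  is_derive t 1 (fun s => ln (nu (x s)))
    (('d nu (x t) : 'cV[R]_n -> R) x' / nu (x t)).
Proof.
move=> nu_norm nu_C1 xt_neq0 dx.
have dnu := is_derive_comp_differentiable dx (nu_C1 _ xt_neq0).1.
have dln := is_derive1_ln (is_norm_gt0 nu_norm xt_neq0).
by rewrite mulrC; exact: is_derive1_comp.
Qed.

Lemma trajectory_neq0 (R : realType) (n : nat) (a b t : R) (A : R -> 'M[R]_n)
    (Phi : R -> R -> 'M[R]_n) (x : 'cV[R]_n) :
  {within `[a, b], continuous A} -> solution_operator a b A Phi ->
  t \in `[a, b] -> x != 0 -> Phi t a *m x != 0.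
Proof.
move=> A_cont Phi_sol t_ab; apply: contra_neq => Phix.
have Phi_unit := solution_operator_unit A_cont Phi_sol t_ab.
by rewrite -(mulKmx Phi_unit x) Phix mulmx0.
Qed.

Lemma continuous_ln_norm_trajectory (R : realType) (n : nat)
    (nu : 'cV[R]_n -> R) (a b : R) (A : R -> 'M[R]_n)
    (Phi : R -> R -> 'M[R]_n) (x : 'cV[R]_n) :
  is_norm nu -> C1_off_zero nu -> {within `[a, b], continuous A} ->
  solution_operator a b A Phi -> a <= b -> x != 0 ->
  {within `[a, b], continuous (fun t => ln (nu (Phi t a *m x)))}.
Proof.
move=> nu_norm nu_C1 A_cont Phi_sol ab x_neq0.
have a_ab : a \in `[a, b] by rewrite in_itv /= lexx.
have Phi_cont := solution_operator_continuous Phi_sol a_ab.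
have x_cont : {within `[a, b], continuous (fun=> x)}.
  by apply: continuous_subspaceT => t; exact: cvg_cst.
have /subspace_continuousP Phix_cont := within_continuous_mulmx Phi_cont x_cont.
apply/subspace_continuousP => t t_ab.
have Phix_neq0 := trajectory_neq0 A_cont Phi_sol t_ab x_neq0.
have nu_cont := differentiable_continuous (nu_C1 _ Phix_neq0).1.
have ln_cont := continuous_ln (is_norm_gt0 nu_norm Phix_neq0).
exact: (continuous_cvg _ ln_cont (continuous_cvg _ nu_cont (Phix_cont t t_ab))).
Qed.

(** Scaling the initial value adds a constant to the logarithm of the norm, which
    cancels in the quotient; initial values need not be normalized. *)
Lemma quotient_le_growth_rate (R : realType) (n : nat) (nu : 'cV[R]_n -> R)
    (a b t s : R) (A : R -> 'M[R]_n) (Phi : R -> R -> 'M[R]_n) (x : 'cV[R]_n) :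
  is_norm nu -> {within `[a, b], continuous A} -> solution_operator a b A Phi ->
  x != 0 -> t \in `[a, b] -> s \in `[a, b] -> t != s ->
  (((ln (nu (Phi t a *m x)) - ln (nu (Phi s a *m x))) / (t - s))%:E
     <= upper_growth_rate nu a b Phi)%E.
Proof.
move=> nu_norm A_cont Phi_sol x_neq0 t_ab s_ab ts; apply: ereal_sup_ubound.
exists ((nu x)^-1 *: x), t, s; split => //; first exact: normalize_unit_sphere.
have c_gt0 : 0 < (nu x)^-1 by rewrite invr_gt0 is_norm_gt0.
have scale_ln u : u \in `[a, b] -> ln (nu (Phi u a *m ((nu x)^-1 *: x)))
    = ln (nu x)^-1 + ln (nu (Phi u a *m x)).
  move=> u_ab; rewrite -scalemxAr is_norm_homog // gtr0_norm // lnM //.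
  by rewrite posrE is_norm_gt0 // (trajectory_neq0 A_cont Phi_sol).
by rewrite !scale_ln // opprD addrACA subrr add0r.
Qed.

(** The mean value theorem gives one inequality.  For the other one, the solution
    starting at (Phi t a)^-1 v is at v at time t, and its logarithmic derivative
    there is a limit of difference quotients. *)
Lemma upper_growth_rateE (R : realType) (n : nat) (nu : 'cV[R]_n -> R)
    (a b : R) (A : R -> 'M[R]_n) (Phi : R -> R -> 'M[R]_n) :
  is_norm nu -> C1_off_zero nu -> a < b -> {within `[a, b], continuous A} ->
  solution_operator a b A Phi ->
  upper_growth_rate nu a b Phi = infinitesimal_growth nu a b A.
Proof.
move=> nu_norm nu_C1 ab A_cont Phi_sol.
have a_ab : a \in `[a, b] by rewrite in_itv /= lexx ltW.
have b_ab : b \in `[a, b] by rewrite in_itv /= lexx ltW.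
pose f x u := ln (nu (Phi u a *m x)).
have df x u : x != 0 -> u \in `]a, b[ -> is_derive u 1 (f x)
    (('d nu (Phi u a *m x) : 'cV[R]_n -> R) (A u *m (Phi u a *m x))
      / nu (Phi u a *m x)).
  move=> x_neq0 u_ab; have u_ab' := subset_itv_oo_cc u_ab.
  apply: is_derive_ln_norm => //.
    exact: (trajectory_neq0 A_cont Phi_sol).
  have dPhi := solution_operator_is_derive Phi_sol a_ab u_ab.
  have := is_derive_mulmx dPhi (is_derive_cst x u 1).
  by rewrite mulmx0 addr0 mulmxA.
apply/eqP; rewrite eq_le; apply/andP; split.
- apply: ge_ereal_sup => _ [x [t [s [x_unit t_ab s_ab ts ->]]]].
  have x_neq0 : x != 0.
    apply: contra_eq_neq (x_unit : nu x = 1) => ->.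
    by rewrite is_norm0 // eq_sym oner_eq0.
  wlog s_lt_t : t s t_ab s_ab ts / s < t.
    move=> wlog_lt; have [st|st|st] := ltgtP s t; first exact: wlog_lt.
      by rewrite -opprB -[t - s]opprB divrNN; apply: wlog_lt; rewrite // eq_sym.
    by rewrite st eqxx in ts.
  have st_sub : {subset `]s, t[ <= `]a, b[}.
    move: s_ab t_ab; rewrite !in_itv /= => /andP[as_ _] /andP[_ tb] u.
    by rewrite !in_itv /= => /andP[su ut]; rewrite (le_lt_trans as_) ?(lt_le_trans ut).
  have f_cont : {within `[s, t], continuous (f x)}.
    apply: continuous_subspaceW
      (continuous_ln_norm_trajectory nu_norm nu_C1 A_cont Phi_sol (ltW ab) x_neq0).
    move: s_ab t_ab; rewrite !in_itv /= => /andP[as_ _] /andP[_ tb].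
    by apply: subset_itv; rewrite bnd_simp.
  have [c c_st ->] := MVT s_lt_t (fun u u_st => df x u x_neq0 (st_sub u u_st)) f_cont.
  rewrite mulfK ?subr_eq0 //; apply: ereal_sup_ubound.
  exists c, (Phi c a *m x); split => //; first exact: st_sub.
  exact: (trajectory_neq0 A_cont Phi_sol (subset_itv_oo_cc (st_sub c c_st))).
- apply: ge_ereal_sup => _ [t [v [t_ab v_neq0 ->]]].
  have t_ab' := subset_itv_oo_cc t_ab.
  have Phi_unit := solution_operator_unit A_cont Phi_sol t_ab'.
  pose x := invmx (Phi t a) *m v.
  have Phix : Phi t a *m x = v by rewrite mulKVmx.
  have x_neq0 : x != 0.
    by apply: contra_neq v_neq0 => x0; rewrite -Phix x0 mulmx0.
  have quot_le u s := @quotient_le_growth_rate _ _ _ _ _ u s _ _ _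
    nu_norm A_cont Phi_sol x_neq0.
  (* A limit of quotients is a real limit, so the two infinite values of the
     supremum are handled apart; -oo is impossible as some quotient exists. *)
  case: (upper_growth_rate nu a b Phi) quot_le => [r|_|quot_le].
  + move=> quot_le; have [f_der f_eq] := df x t x_neq0 t_ab.
    rewrite Phix in f_eq; rewrite lee_fin -f_eq.
    apply: (cvgr_to_le f_der); near=> h.
    have h_neq0 : h != 0 by near: h; exact: nbhs_dnbhs_neq.
    have ht_ab : h + t \in `[a, b].
      apply: subset_itv_oo_cc; near: h.
      have [e e_gt0 ab_e] := near_in_itvoo t_ab; exists e => // h.
      rewrite /ball_ /= sub0r normrN => h_e _; apply: ab_e.
      by rewrite /ball_ /= opprD addrCA subrr addr0 normrN.
    have := quot_le (h + t) t ht_ab t_ab'.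
    rewrite -subr_eq0 addrK lee_fin mulrC => /(_ h_neq0).
    by rewrite /= [h *: 1]mulr1.
  + by rewrite leey.
  + have := quot_le b a b_ab a_ab; rewrite gt_eqF // => /(_ isT).
    by rewrite leeNy_eq.
Unshelve. all: by end_near. Qed.

(** * Perturbations and the stability radius *)

Lemma op_norm_ge (R : realType) (n : nat) (nu : 'cV[R]_n -> R) (M : 'M[R]_n)
    (v : 'cV[R]_n) :
  is_norm nu -> v != 0 -> ((nu (M *m v) / nu v)%:E <= op_norm nu M)%E.
Proof.
move=> nu_norm v_neq0; apply: ereal_sup_ubound.
exists ((nu v)^-1 *: v); first exact: normalize_unit_sphere.
have v_gt0 := is_norm_gt0 nu_norm v_neq0.
rewrite -scalemxAr is_norm_homog // ger0_norm; last by rewrite invr_ge0 ltW.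
by rewrite mulrC.
Qed.

Lemma op_norm_scalar_le (R : realType) (n : nat) (nu : 'cV[R]_n -> R) (c : R) :
  is_norm nu -> (op_norm nu c%:M <= `|c|%:E)%E.
Proof.
move=> nu_norm; apply: ge_ereal_sup => _ [x x_unit <-].
by rewrite mul_scalar_mx is_norm_homog // (x_unit : nu x = 1) mulr1.
Qed.

(** The differential is additive, and its value at B v is at most nu (B v). *)
Lemma infinitesimal_growth_perturb (R : realType) (n : nat)
    (nu : 'cV[R]_n -> R) (a b : R) (A B : R -> 'M[R]_n) :
  is_norm nu -> C1_off_zero nu ->
  (infinitesimal_growth nu a b (fun t => (A t + B t)%R)
     <= infinitesimal_growth nu a b A + sup_norm nu a b B)%E.
Proof.
move=> nu_norm nu_C1; apply: ge_ereal_sup => _ [t [v [t_ab v_neq0 ->]]].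
have nu_diff := (nu_C1 v v_neq0).1; have v_gt0 := is_norm_gt0 nu_norm v_neq0.
rewrite mulmxDl linearD /= mulrDl EFinD; apply: leeD.
  by apply: ereal_sup_ubound; exists t, v.
apply: (@le_trans _ _ (op_norm nu (B t))).
  apply: le_trans (op_norm_ge (B t) nu_norm v_neq0).
  by rewrite lee_fin ler_pM2r ?invr_gt0 // diff_norm_le.
by apply: ereal_sup_ubound; exists t => //; exact: subset_itv_oo_cc.
Qed.

(** By Euler's identity the multiple c v contributes exactly c nu v. *)
Lemma infinitesimal_growth_shift (R : realType) (n : nat)
    (nu : 'cV[R]_n -> R) (a b c : R) (A : R -> 'M[R]_n) :
  is_norm nu -> C1_off_zero nu ->
  (infinitesimal_growth nu a b A
     <= infinitesimal_growth nu a b (fun t => (A t + c%:M)%R) - c%:E)%E.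
Proof.
move=> nu_norm nu_C1; apply: ge_ereal_sup => _ [t [v [t_ab v_neq0 ->]]].
have nu_diff := (nu_C1 v v_neq0).1; have v_gt0 := is_norm_gt0 nu_norm v_neq0.
rewrite leeBrDr // -EFinD; apply: ereal_sup_ubound; exists t, v; split => //.
rewrite mulmxDl linearD /= mul_scalar_mx linearZ /= diff_norm_self //.
by rewrite mulrDl [c *: _ / _]mulfK // gt_eqF.
Qed.

Theorem theorem5p4 (R : realType) (n : nat) (n_ge1 : (1 <= n)%N)
    (nu : 'cV[R]_n -> R) (nu_norm : is_norm nu) (nu_C1 : C1_off_zero nu)
    (tm tp : R) (tm_lt_tp : tm < tp)
    (A : R -> 'M[R]_n) (A_cont : {within `[tm, tp], continuous A})
    (Phi : R -> R -> 'M[R]_n) (Phi_sol : solution_operator tm tp A Phi)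
    (Phi_attr : attractive nu tm tp Phi) :
  stability_radius nu tm tp A = (- upper_growth_rate nu tm tp Phi)%E.
Proof.
have tm_in : tm \in `[tm, tp] by rewrite in_itv /= lexx ltW.
have tp_in : tp \in `[tm, tp] by rewrite in_itv /= lexx ltW.
have growthE := upper_growth_rateE nu_norm nu_C1 tm_lt_tp.
have [v v_neq0] : exists v : 'cV[R]_n, v != 0.
  exists (const_mx 1); apply/eqP => /matrixP/(_ (Ordinal n_ge1) 0)/eqP.
  by rewrite !mxE oner_eq0.
have [lambda growth_eq] : exists lambda, upper_growth_rate nu tm tp Phi = lambda%:E.
  have := quotient_le_growth_rate nu_norm A_cont Phi_sol v_neq0 tp_in tm_in.
  rewrite gt_eqF // => /(_ isT); move: Phi_attr; rewrite /attractive.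
  by case: (upper_growth_rate _ _ _ _) => [r| |] //; exists r.
have lambda_lt0 : lambda < 0 by move: Phi_attr; rewrite /attractive growth_eq lte_fin.
apply/eqP; rewrite eq_le; apply/andP; split.
(* The perturbation by - lambda shifts the growth rate to 0. *)
- have B_cont : {within `[tm, tp], continuous (fun=> (- lambda)%:M : 'M[R]_n)}.
    by apply: continuous_subspaceT => t; exact: cvg_cst.
  apply: (@le_trans _ _ (sup_norm nu tm tp (fun=> (- lambda)%:M : 'M[R]_n))).
    apply: ereal_inf_lbound; exists (fun=> (- lambda)%:M) => //; split => //.
    case=> Psi Psi_sol; rewrite /attractive.
    have AB_cont := within_continuousD A_cont B_cont.
    rewrite (growthE _ _ AB_cont Psi_sol) => Psi_lt0.
    have := infinitesimal_growth_shift tm tp (- lambda) A nu_norm nu_C1.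
    rewrite -(growthE _ _ A_cont Phi_sol) growth_eq leeBrDr //.
    by rewrite -EFinD subrr leNgt Psi_lt0.
  rewrite growth_eq; apply: ge_ereal_sup => _ [t _ <-].
  apply: le_trans (op_norm_scalar_le _ nu_norm) _.
  by rewrite normrN ltr0_norm.
(* A perturbation of norm less than - lambda keeps the growth rate negative. *)
- apply: le_ereal_inf_tmp => _ [B [B_cont B_not_attr] <-].
  rewrite leNgt; apply/negP => B_lt; apply: B_not_attr.
  have AB_cont : {within `[tm, tp], continuous (fun t => A t + B t)}.
    exact: within_continuousD A_cont B_cont.
  have [Psi Psi_sol] := solution_operator_exists (ltW tm_lt_tp) AB_cont.
  exists Psi => //; rewrite /attractive (growthE _ _ AB_cont Psi_sol).
  apply: le_lt_trans (infinitesimal_growth_perturb _ _ _ _ nu_norm nu_C1) _.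
  rewrite -(growthE _ _ A_cont Phi_sol) growth_eq.
  move: B_lt; rewrite growth_eq.
  case: (sup_norm nu tm tp B) => [r||] //=.
    by rewrite -EFinD !lte_fin; lra.
  by rewrite addeNy ltNyr.
Qed.
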